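(* Let $n\ge1$. The restriction of $\Psi$ to $\mathfrak{S}_n(213)$ is a bijection from $\mathfrak{S}_n(213)$ onto $\mathfrak{S}_n(321)$.
   Context: $\mathfrak{S}_n(\tau)$ is the set of permutations of $[n]$ avoiding the classical pattern $\tau$. The map $\Phi:\mathfrak{S}_m\to\mathfrak{S}_m$: for $\rho\in\mathfrak{S}_m$, a letter $\rho(i)$ is a descent top if $i\le m-1$ and $\rho(i)>\rho(i+1)$, a descent bottom if $i\ge2$ and $\rho(i-1)>\rho(i)$; otherwise a nondescent top (resp. bottom). For $x=\rho(i)$ let $c(x)=\#\{j:i<j<m,\ \rho(j+1)<x<\rho(j)\}$. Let $f$ (resp. $g$) be the increasing word of descent bottoms (resp. nondescent bottoms); $f'$ the arrangement of descent tops in which each letter $x$ has exactly $c(x)$ larger letters to its left; $g'$ the arrangement of nondescent tops in which each letter $x$ has exactly $c(x)$ smaller letters to its right. With the two-row array of top row $fg$ and bottom row $f'g'$, $\Phi(\rho)=\tau$ with $\tau(b)=a$ for each column (top $a$, bottom $b$). The map $\Psi:\mathfrak{S}_n\to\mathfrak{S}_n$: for $\sigma\in\mathfrak{S}_n$ let $\hat\sigma\in\mathfrak{S}_{n+1}$, $\hat\sigma(i)=\sigma(i)+1$ for $i\le n$, $\hat\sigma(n+1)=1$; $\tau=\Phi(\hat\sigma)$ has $\tau(1)=n+1$, and $\Psi(\sigma)=\tau(2)\cdots\tau(n+1)$. *)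

(* Defs.v *)
From mathcomp Require Import all_boot.
Set Implicit Arguments. Unset Strict Implicit. Unset Printing Implicit Defensive.

(* Permutations of [n] are represented as words (seq nat) in one-line notation,
   with letters 1..n.  Positions in the Rocq words are 0-based: rho(i) (1-based)
   is [nth 0 rho (i-1)]. *)

Definition is_permn (n : nat) (s : seq nat) : bool := perm_eq s (iota 1 n).

Definition order_iso (t p : seq nat) : Prop :=
  size t = size p /\
  forall i j, i < size p -> j < size p ->
    (nth 0 t i < nth 0 t j) = (nth 0 p i < nth 0 p j).

Definition contains (s p : seq nat) : Prop := exists t, subseq t s /\ order_iso t p.
Definition avoids (s p : seq nat) : Prop := ~ contains s p.

Definition is_desc_top (r : seq nat) (j : nat) : bool :=
  (j.+1 < size r) && (nth 0 r j.+1 < nth 0 r j).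
Definition is_desc_bot (r : seq nat) (j : nat) : bool :=
  (0 < j < size r) && (nth 0 r j < nth 0 r j.-1).

(* c(x) = #{ j : i < j < m, rho(j+1) < x < rho(j) } where x = rho(i) (1-based);
   in 0-based positions: i0 = index x r, j0 ranges over i0+1 .. m-2. *)
Definition cval (r : seq nat) (x : nat) : nat :=
  let i := index x r in
  count (fun j => (nth 0 r j.+1 < x) && (x < nth 0 r j)) (iota i.+1 (size r - i.+2)).

Definition desc_tops (r : seq nat) : seq nat :=
  [seq nth 0 r j | j <- iota 0 (size r) & is_desc_top r j].
Definition nondesc_tops (r : seq nat) : seq nat :=
  [seq nth 0 r j | j <- iota 0 (size r) & ~~ is_desc_top r j].
Definition desc_bots (r : seq nat) : seq nat :=
  [seq nth 0 r j | j <- iota 0 (size r) & is_desc_bot r j].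
Definition nondesc_bots (r : seq nat) : seq nat :=
  [seq nth 0 r j | j <- iota 0 (size r) & ~~ is_desc_bot r j].

(* "the arrangement of D satisfying P": the first rearrangement of D satisfying P
   (the paper asserts it exists and is unique); D itself if none exists. *)
Definition arrange (P : seq nat -> bool) (D : seq nat) : seq nat :=
  nth D [seq t <- permutations D | P t] 0.

Definition f' (r : seq nat) : seq nat :=
  arrange (fun t => all (fun x => count (fun y => x < y) (take (index x t) t) == cval r x) t)
          (desc_tops r).
Definition g' (r : seq nat) : seq nat :=
  arrange (fun t => all (fun x => count (fun y => y < x) (drop (index x t).+1 t) == cval r x) t)
          (nondesc_tops r).

Definition f_ (r : seq nat) : seq nat := sort leq (desc_bots r).
Definition g_ (r : seq nat) : seq nat := sort leq (nondesc_bots r).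

(* Phi(rho) = tau with tau(b) = a for each column (top a, bottom b) of the
   two-row array with top row f g and bottom row f' g'. *)
Definition Phi (r : seq nat) : seq nat :=
  let top := f_ r ++ g_ r in
  let bot := f' r ++ g' r in
  [seq nth 0 top (index k bot) | k <- iota 1 (size r)].

Definition sigma_hat (s : seq nat) : seq nat := rcons (map S s) 1.
Definition Psi (s : seq nat) : seq nat := behead (Phi (sigma_hat s)).

(* Main.v *)
(* Let r be a 213-avoiding word ending with its minimum 1.  To the right of a
   letter x the larger letters come first, so c(x) is 0 if x is a descent top or
   1, and is 1 otherwise.  Hence f' is increasing, and g' is increasing except
   for its last letter 1: deleting the first letter of tau = Phi(r), tau maps
   the sorted descent tops to the sorted descent bottoms, and the sorted ascent
   bottoms to the sorted remaining values.  Being a union of two increasing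
   words, Psi(s) avoids 321.  Moreover tau(k) < k exactly when k is a descent
   top, so Psi(s) determines the sets of descent tops and descent bottoms, and
   these determine a 213-avoiding word letter by letter from right to left.
   Conversely, the deficiencies of a 321-avoiding permutation prescribe two such
   sets, and inserting the letters from the largest to the smallest builds a
   213-avoiding word realizing them. *)
Require Import Defs.
From mathcomp Require Import all_boot zify.
Set Implicit Arguments. Unset Strict Implicit. Unset Printing Implicit Defensive.

(** * Pattern avoidance as a boolean condition on triples of letters *)

Fixpoint triple_free (T : nat -> nat -> nat -> bool) (s : seq nat) : bool :=
  if s is x :: s' then
    pairwise (fun y z => ~~ T x y z) s' && triple_free T s'
  else true.

Lemma triple_free_subseq T s1 s2 :
  subseq s1 s2 -> triple_free T s2 -> triple_free T s1.
Proof.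
elim: s2 s1 => [|y s2 IH] [|x s1] //=.
case: eqP => [->|_] sub12 /andP[pw tf].
  by rewrite (subseq_pairwise sub12 pw) (IH _ sub12 tf).
exact: (IH (x :: s1)).
Qed.

Lemma triple_freeP T s :
  reflect (forall a b c, subseq [:: a; b; c] s -> ~~ T a b c) (triple_free T s).
Proof.
apply: (iffP idP) => [tf a b c sub|].
  by have := triple_free_subseq sub tf; rewrite /= !andbT.
elim: s => //= x s IH free; apply/andP; split; last first.
  by apply: IH => a b c sub; apply: free; case: eqP => // _; apply: subseq_trans (subseq_cons _ _) sub.
have {}free b c : subseq [:: b; c] s -> ~~ T x b c.
  by move=> sub; apply: free; rewrite eqxx.
elim: s {IH} free => //= y s IH free; apply/andP; split; last first.
  apply: IH => b c sub; apply: free; case: eqP => // _.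
  exact: subseq_trans (subseq_cons _ _) sub.
by apply/allP => z zs; apply: free; rewrite eqxx sub1seq.
Qed.

Definition is213 a b c := b < a < c.
Definition is321 a b c := c < b < a.

Lemma avoids213P s : avoids s [:: 2; 1; 3] <-> triple_free is213 s.
Proof.
split=> [av | /triple_freeP tf [[|a [|b [|c [|? ?]]]] [sub [//= _ iso]]]].
  apply/triple_freeP => a b c sub; apply/negP => /andP[ba ac]; apply: av.
  exists [:: a; b; c]; split=> //; split=> // i j.
  by case: i => [|[|[|//]]] _; case: j => [|[|[|//]]] _ /=; lia.
have := tf a b c sub; rewrite /is213.
by have /= := iso 1 0 isT isT; have /= := iso 0 2 isT isT => -> ->.
Qed.

Lemma avoids321P s : avoids s [:: 3; 2; 1] <-> triple_free is321 s.
Proof.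
split=> [av | /triple_freeP tf [[|a [|b [|c [|? ?]]]] [sub [//= _ iso]]]].
  apply/triple_freeP => a b c sub; apply/negP => /andP[ba ac]; apply: av.
  exists [:: a; b; c]; split=> //; split=> // i j.
  by case: i => [|[|[|//]]] _; case: j => [|[|[|//]]] _ /=; lia.
have := tf a b c sub; rewrite /is321.
by have /= := iso 2 1 isT isT; have /= := iso 1 0 isT isT => -> ->.
Qed.

(** * Descents and ascents as pairs of consecutive letters *)

Definition adj (r : seq nat) := zip r (behead r).
Definition desc r := [seq p <- adj r | p.2 < p.1].
(** The weak inequality makes [asc] the complement of [desc] in [adj]; in a word without repetition
    it holds strictly. *)
Definition asc r := [seq p <- adj r | p.1 <= p.2].

Lemma unzip1_adj x r : unzip1 (adj (x :: r)) = belast x r.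
Proof. by rewrite /adj /=; elim: r x => //= y r IH x; rewrite IH. Qed.

Lemma unzip2_adj r : unzip2 (adj r) = behead r.
Proof. by rewrite unzip2_zip // size_behead leq_pred. Qed.

Lemma adjP r a b :
  reflect (exists X Y, r = X ++ a :: b :: Y) ((a, b) \in adj r).
Proof.
apply: (iffP idP) => [|[X [Y ->]]].
  elim: r => [|x [|y r] IH] //.
  rewrite inE => /orP[/eqP[-> ->]|/IH[X [Y ->]]]; first by exists [::], r.
  by exists (x :: X), Y.
by elim: X => [|x [|y X] IH] /=; rewrite !inE ?eqxx ?orbT //; move: IH => /= ->; rewrite orbT.
Qed.


Lemma adj_nth r : adj r = [seq (nth 0 r j, nth 0 r j.+1) | j <- iota 0 (size r).-1].
Proof.
elim: r => [|x [|y r] IH] //; rewrite -[LHS]/((x, y) :: adj (y :: r)) IH /=.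
by rewrite (iotaDl 1 0) -map_comp.
Qed.

Lemma iota_rcons a k : iota a k.+1 = rcons (iota a k) (a + k).
Proof. by rewrite -[k.+1]addn1 iotaD cats1. Qed.

Lemma desc_topsE r : desc_tops r = unzip1 (desc r).
Proof.
case: r => // x r; rewrite /desc_tops /desc adj_nth filter_map /unzip1 -map_comp.
rewrite iota_rcons filter_rcons {1}/is_desc_top ltnn /=; congr map.
by apply: eq_in_filter => j; rewrite mem_iota /is_desc_top /= ltnS => ->.
Qed.

(** The last letter has no successor, so it counts as a nondescent top without starting an
    ascent. *)
Lemma nondesc_topsE x r :
  nondesc_tops (x :: r) = rcons (unzip1 (asc (x :: r))) (last x r).
Proof.
rewrite /nondesc_tops /asc adj_nth filter_map /unzip1 -map_comp.
rewrite iota_rcons filter_rcons {1}/is_desc_top ltnn /= map_rcons.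
rewrite -[nth 0 (x :: r) (size r)]/(nth 0 (x :: r) (size (x :: r)).-1) nth_last.
congr (rcons (map _ _) _).
by apply: eq_in_filter => j; rewrite mem_iota /is_desc_top /= ltnS => ->; rewrite -leqNgt.
Qed.

Lemma desc_botsE r : desc_bots r = unzip2 (desc r).
Proof.
case: r => // x r; rewrite /desc_bots /desc adj_nth filter_map /unzip2 -map_comp /=.
rewrite (iotaDl 1 0) filter_map -map_comp; congr map.
by apply: eq_in_filter => j; rewrite mem_iota /is_desc_bot /= ltnS => ->.
Qed.

Lemma nondesc_botsE x r : nondesc_bots (x :: r) = x :: unzip2 (asc (x :: r)).
Proof.
rewrite /nondesc_bots /asc adj_nth filter_map /unzip2 -map_comp /=.
rewrite (iotaDl 1 0) filter_map -map_comp; congr (_ :: map _ _).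
by apply: eq_in_filter => j; rewrite mem_iota /is_desc_bot /= ltnS => ->; rewrite -leqNgt.
Qed.

(* A word avoiding 213 has, to the right of [x], first letters larger than [x]
   and then letters smaller than [x]. *)
Lemma count_straddle (x : nat) (w : seq nat) :
  x \notin w -> pairwise (fun y z => ~~ is213 x y z) w -> last x w < x ->
  count (fun p => p.2 < x < p.1) (adj w) = (x < head x w).
Proof.
elim: w => [|y [|z w] IH] /=; rewrite ?ltnn //.
  by move=> _ _ yx; rewrite ltnNge ltnW.
move: IH => /= IH; rewrite inE negb_or => /andP[xy xw] /andP[/andP[yz pwy] pwz] lst.
rewrite IH //.
move: yz xy xw; rewrite /is213 !inE negb_or => yz xy /andP[xz _].
by case: (ltngtP z x) yz xz; case: (ltngtP y x) xy => //=; lia.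
Qed.

Lemma cvalE (X : seq nat) (x : nat) (w : seq nat) :
  x \notin X -> cval (X ++ x :: w) x = count (fun p => p.2 < x < p.1) (adj w).
Proof.
move=> xX; rewrite /cval index_cat (negbTE xX) /= eqxx addn0.
rewrite size_cat /= adj_nth count_map.
have -> : size X + (size w).+1 - (size X).+2 = (size w).-1 by lia.
rewrite -[(size X).+1]addn0 iotaDl count_map; apply: eq_count => j /=.
have shift i : nth 0 (X ++ x :: w) ((size X).+1 + i) = nth 0 w i.
  rewrite nth_cat ifN; last by lia.
  by have -> : (size X).+1 + i - size X = i.+1 by lia.
by rewrite -addnS !shift.
Qed.

(** * The two-row array of a 213-avoiding word *)

(** The filtered list contains [t0], so [nth] does not fall back on its default value. *)
Lemma arrange_unique (P : seq nat -> bool) (D t0 : seq nat) :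
  P t0 -> perm_eq t0 D -> (forall t, perm_eq t D -> P t -> t = t0) ->
  arrange P D = t0.
Proof.
move=> Pt0 t0D uniqP; rewrite /arrange.
set fl := filter _ _; have t0fl : t0 \in fl by rewrite mem_filter Pt0 mem_permutations.
have : nth D fl 0 \in fl by apply: mem_nth; case: fl t0fl.
by rewrite mem_filter mem_permutations => /andP[Pt tD]; apply: uniqP.
Qed.

Lemma pairwise_sort (s t : seq nat) : perm_eq t s -> pairwise leq t -> t = sort leq s.
Proof.
move=> ts; rewrite -(sorted_pairwise leq_trans) => sorted_t.
apply: (sorted_eq leq_trans anti_leq) => //; first exact: sort_sorted leq_total _.
by rewrite perm_sym perm_sort perm_sym.
Qed.

Lemma pairwise_leq_sort s : pairwise leq (sort leq s).
Proof. by rewrite -(sorted_pairwise leq_trans) sort_sorted //; apply: leq_total. Qed.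

(** Written as a filtered interval, a sorted row depends only on the membership of letters. *)
Lemma sort_iota a n (s : seq nat) :
  uniq s -> {subset s <= iota a n} -> sort leq s = [seq x <- iota a n | x \in s].
Proof.
move=> us sub; apply/esym/pairwise_sort; last first.
  rewrite -(sorted_pairwise leq_trans) sorted_filter ?iota_sorted //.
  exact: leq_trans.
apply: uniq_perm; rewrite ?filter_uniq ?iota_uniq // => x.
by rewrite mem_filter; case xs: (x \in s) => //; rewrite (sub x xs).
Qed.

Lemma all_count_left (t : seq nat) : uniq t ->
  all (fun x => count (fun y => x < y) (take (index x t) t) == 0) t = pairwise leq t.
Proof.
elim: t => //= z t IH /andP[zt ut]; rewrite eqxx take0 /= -IH // -all_predI.
apply: eq_in_all => x xt /=.
have /negbTE-> : z != x by apply: contraNneq zt => ->.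
by rewrite /= addn_eq0 eqb0 -leqNgt.
Qed.

Lemma all_count_right (t : seq nat) : uniq t ->
  all (fun x => count (fun y => y < x) (drop (index x t).+1 t) == 0) t = pairwise leq t.
Proof.
elim: t => //= z t IH /andP[zt ut]; rewrite eqxx drop0 -IH //; congr (_ && _).
  rewrite eqn0Ngt -has_count -all_predC; apply: eq_all => x /=.
  by rewrite -leqNgt.
apply: eq_in_all => x xt /=.
by have /negbTE-> : z != x by apply: contraNneq zt => ->.
Qed.

(** Each letter above [1] already has the final [1] as its single smaller letter to the right, so
    the other letters show no inversion. *)
Lemma all_count_right_rcons (t : seq nat) : uniq t -> {in t, forall x, 1 < x} ->
  all (fun x => count (fun y => y < x) (drop (index x (rcons t 1)).+1 (rcons t 1))
                == (1 < x)) (rcons t 1) = pairwise leq t.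
Proof.
move=> ut t1; rewrite all_rcons -all_count_right //.
have t1' : 1 \notin t by apply/negP => /t1.
rewrite -cats1 index_cat (negbTE t1') /= addn0 drop_oversize ?size_cat ?addn1 //=.
apply: eq_in_all => x xt; rewrite index_cat xt drop_cat.
case: ltnP => [_|]; last first.
  move=> le; have := xt; rewrite -index_mem => lt.
  have -> : (index x t).+1 - size t = 0 by apply/eqP; rewrite subn_eq0.
  by rewrite drop0 drop_oversize /= ?(t1 x xt).
by rewrite count_cat /= (t1 x xt) !addn1 eqSS.
Qed.

Lemma perm_desc_asc r : perm_eq (desc r ++ asc r) (adj r).
Proof.
have <- : [seq p <- adj r | predC (fun p => p.2 < p.1) p] = asc r.
  by apply: eq_filter => p /=; rewrite -leqNgt.
by rewrite perm_filterC.
Qed.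

Lemma unzip1_adj_rcons (u : seq nat) z : unzip1 (adj (rcons u z)) = u.
Proof. by case: u => // x u; rewrite unzip1_adj belast_rcons. Qed.

(** The two-row array without its last column, which has top [n.+1] and bottom [1]; [behead] drops
    the value given by that column. The rows take predicates as arguments, so that sets prescribed
    in advance fit as well. *)
Definition fill_bot n (D : pred nat) :=
  [seq k <- iota 2 n | D k] ++ [seq k <- iota 2 n | ~~ D k].
Definition fill_top n (B : pred nat) :=
  [seq b <- iota 1 n | B b] ++ [seq b <- iota 1 n | ~~ B b].
Definition fill n (D B : pred nat) k :=
  nth 0 (fill_top n B) (index k (fill_bot n D)).

Section Hat.
Variables (n : nat) (u : seq nat).
Hypothesis perm_u : perm_eq u (iota 2 n).
Let r := rcons u 1.

Lemma perm_r : perm_eq r (iota 1 n.+1).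
Proof. by rewrite perm_rcons /= perm_cons. Qed.

Lemma uniq_r : uniq r. Proof. by rewrite (perm_uniq perm_r) iota_uniq. Qed.

Lemma perm_tops : perm_eq (unzip1 (desc r) ++ unzip1 (asc r)) u.
Proof.
by rewrite -map_cat -[X in perm_eq _ X](unzip1_adj_rcons u 1) perm_map ?perm_desc_asc.
Qed.

Lemma perm_bots : perm_eq (unzip2 (desc r) ++ head 1 r :: unzip2 (asc r)) r.
Proof.
have rE : r = head 1 r :: behead r by rewrite /r; case: (u).
rewrite [X in perm_eq _ X]rE perm_catC /= perm_cons -unzip2_adj perm_catC.
by rewrite -map_cat perm_map ?perm_desc_asc.
Qed.

Lemma uniq_u : uniq u. Proof. by rewrite (perm_uniq perm_u) iota_uniq. Qed.

Lemma u_gt1 : {in u, forall x, 1 < x}.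
Proof. by move=> x; rewrite (perm_mem perm_u) mem_iota => /andP[]. Qed.

Lemma uniq_tops : uniq (unzip1 (desc r) ++ unzip1 (asc r)).
Proof. by rewrite (perm_uniq perm_tops) uniq_u. Qed.

Lemma uniq_bots : uniq (unzip2 (desc r) ++ head 1 r :: unzip2 (asc r)).
Proof. by rewrite (perm_uniq perm_bots) uniq_r. Qed.

Lemma sub_desc_tops : {subset unzip1 (desc r) <= u}.
Proof. by move=> x xD; rewrite -(perm_mem perm_tops) mem_cat xD. Qed.

Lemma sub_asc_bots : {subset unzip1 (asc r) <= u}.
Proof. by move=> x xA; rewrite -(perm_mem perm_tops) mem_cat xA orbT. Qed.

Lemma desc_bots_leq_n : {subset unzip2 (desc r) <= iota 1 n}.
Proof.
move=> b /mapP[[a b']]; rewrite mem_filter /= => /andP[ba ab] ->.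
have au : a \in u by rewrite -(unzip1_adj_rcons u 1); apply: (map_f fst ab).
have : b' \in r by rewrite -(perm_mem perm_bots) mem_cat (map_f snd (x := (a, b'))) // mem_filter ba.
by rewrite (perm_mem perm_r); move: au; rewrite (perm_mem perm_u) !mem_iota; lia.
Qed.

Hypothesis free_r : triple_free is213 r.

(** What follows [a] is a word with head [b] and last letter [1], below [a], so [count_straddle]
    applies. *)
Lemma cval_adj a b : (a, b) \in adj r -> cval r a = (a < b).
Proof.
move=> ab; have a_gt1 : 1 < a.
  by apply: u_gt1; rewrite -(unzip1_adj_rcons u 1); apply: (map_f fst ab).
have /adjP[X [Y rE]] := ab.
have := uniq_r; rewrite rE cat_uniq /= => /and3P[_ /norP[aX _] /andP[aY _]].
rewrite cvalE // count_straddle //.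
- have : triple_free is213 (a :: b :: Y).
    by apply: triple_free_subseq free_r; rewrite rE suffix_subseq.
  by case/andP.
have := last_rcons 0 u 1; rewrite -/r rE last_cat /= => ->.
exact: a_gt1.
Qed.

Lemma cval1 : cval r 1 = 0.
Proof. by rewrite /r -cats1 cvalE //; apply/negP => /u_gt1. Qed.

Lemma cval_desc : {in unzip1 (desc r), forall x, cval r x = 0}.
Proof.
move=> x /mapP[[a b]]; rewrite mem_filter /= => /andP[ba ab] ->.
by rewrite (cval_adj ab) ltnNge ltnW.
Qed.

Lemma cval_asc : {in unzip1 (asc r), forall x, cval r x = 1}.
Proof.
move=> x /mapP[[a b]]; rewrite mem_filter /= => /andP[ba ab] ->.
rewrite (cval_adj ab) ltn_neqAle ba andbT.
have /adjP[X [Y rE]] := ab; have := uniq_r.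
rewrite rE cat_uniq /= inE => /and3P[_ _ /andP[/norP[/negbTE aNb _] _]].
by rewrite -/(a != b) aNb.
Qed.

(** [cval] vanishes on descent tops, so the arrangement has no inversion. *)
Lemma f'E : f' r = sort leq (unzip1 (desc r)).
Proof.
have allE t : perm_eq t (unzip1 (desc r)) ->
    all (fun x => count (fun y => x < y) (take (index x t) t) == cval r x) t
    = pairwise leq t.
  move=> tD; rewrite -all_count_left; last first.
    by rewrite (perm_uniq tD); have := uniq_tops; rewrite cat_uniq => /and3P[].
  by apply: eq_in_all => x; rewrite (perm_mem tD) => xD; rewrite cval_desc.
rewrite /f' desc_topsE; apply: arrange_unique => [||t tD].
- by rewrite allE ?pairwise_leq_sort // perm_sort.
- by rewrite perm_sort.
by rewrite allE //; apply: pairwise_sort.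
Qed.

(** Nothing stands to the right of the last letter of the arrangement, so its [cval] is [0], which
    among the nondescent tops singles out [1]. The rest is then increasing by
    [all_count_right_rcons]. *)
Lemma g'E : g' r = rcons (sort leq (unzip1 (asc r))) 1.
Proof.
set A := unzip1 (asc r).
have uA : uniq A by have := uniq_tops; rewrite cat_uniq => /and3P[].
have topsE : perm_eq (nondesc_tops r) (rcons A 1).
  have rE : r = head 1 r :: behead r by rewrite /r; case: (u).
  rewrite rE nondesc_topsE -rE; have := last_rcons 0 u 1.
  by rewrite -/r rE /= => ->; rewrite -rE.
have cvalA x : x \in rcons A 1 -> cval r x = (1 < x).
  rewrite mem_rcons inE => /predU1P[->|xA]; first exact: cval1.
  by rewrite cval_asc // u_gt1 // sub_asc_bots.
have allE t : perm_eq t A ->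
    all (fun x => count (fun y => y < x) (drop (index x (rcons t 1)).+1 (rcons t 1))
                  == cval r x) (rcons t 1) = pairwise leq t.
  move=> tA; rewrite -all_count_right_rcons ?(perm_uniq tA) //; last first.
    by move=> x; rewrite (perm_mem tA) => /sub_asc_bots/u_gt1.
  apply: eq_in_all => x xt; rewrite cvalA //.
  by move: xt; rewrite !mem_rcons !inE (perm_mem tA).
rewrite /g'; apply: arrange_unique => [||t tA].
- by rewrite allE ?pairwise_leq_sort // perm_sort.
- by rewrite perm_sym (permPl topsE) perm_sym perm_rcons perm_sym perm_rcons perm_cons perm_sym perm_sort.
have {}tA : perm_eq t (rcons A 1) by rewrite (permPl tA).
have ut : uniq t.
  by rewrite (perm_uniq tA) rcons_uniq uA andbT; apply/negP => /sub_asc_bots/u_gt1.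
case/lastP: t tA ut => [|t z] tA ut; first by have := perm_size tA; rewrite size_rcons.
have zA : z \in rcons A 1 by rewrite -(perm_mem tA) mem_rcons mem_head.
move=> tP; have {zA} zE : z = 1.
  have z_le1 : (1 < z) = false.
    move: tP; rewrite all_rcons cvalA // => /andP[+ _].
    move: ut; rewrite rcons_uniq => /andP[zt _].
    rewrite -cats1 index_cat (negbTE zt) /= eqxx addn0.
    by rewrite drop_oversize ?size_cat ?addn1 //=; case: (1 < z).
  by move: zA; rewrite mem_rcons inE => /predU1P[//|/sub_asc_bots/u_gt1]; rewrite z_le1.
rewrite {}zE in tA ut tP *.
have {}tA : perm_eq t A by move: tA; rewrite perm_rcons perm_sym perm_rcons perm_cons perm_sym.
by congr rcons; apply: pairwise_sort => //; rewrite -allE.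
Qed.

Lemma behead_PhiE :
  behead (Phi r) =
  [seq fill n (mem (unzip1 (desc r))) (mem (unzip2 (desc r))) k | k <- iota 2 n].
Proof.
have := uniq_tops; have := uniq_bots; rewrite !cat_uniq.
move=> /and3P[uB dB uH] /and3P[uD dD uG].
have rE : r = head 1 r :: behead r by rewrite /r; case: (u).
rewrite /Phi (perm_size perm_r) size_iota /= -/(behead _) f'E g'E.
rewrite /f_ /g_ desc_botsE [X in nondesc_bots X]rE nondesc_botsE -rE.
set D := unzip1 (desc r) in dD uD *; set G := unzip1 (asc r) in dD uG *.
set B := unzip2 (desc r) in dB uB *; set H := _ :: unzip2 (asc r) in dB uH *.
have sDE : sort leq D = [seq k <- iota 2 n | mem D k].
  by apply: sort_iota => // x /sub_desc_tops; rewrite (perm_mem perm_u).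
have sGE : sort leq G = [seq k <- iota 2 n | ~~ mem D k].
  rewrite (@sort_iota 2 n) // => [|x /sub_asc_bots]; last by rewrite (perm_mem perm_u).
  apply: eq_in_filter => x; rewrite -(perm_mem perm_u) -(perm_mem perm_tops) mem_cat.
  rewrite -/D -/G /=; case xG: (x \in G); last by rewrite orbF => ->.
  by have /hasPn/(_ x xG) := dD.
have sBE : sort leq B = [seq b <- iota 1 n | mem B b].
  by apply: sort_iota => // x /desc_bots_leq_n.
(* [n.+1] is no descent bottom and closes the sorted row, facing the final [1] of [g' r]. *)
have sHE : sort leq H = rcons [seq b <- iota 1 n | ~~ mem B b] n.+1.
  have -> : rcons [seq b <- iota 1 n | ~~ mem B b] n.+1 = [seq b <- iota 1 n.+1 | ~~ mem B b].
    rewrite iota_rcons filter_rcons ifT //.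
    by apply/negP => /desc_bots_leq_n; rewrite mem_iota; lia.
  rewrite (@sort_iota 1 n.+1) // => [|x xH]; last first.
    by rewrite -(perm_mem perm_r) -(perm_mem perm_bots) mem_cat xH orbT.
  apply: eq_in_filter => x; rewrite -(perm_mem perm_r) -(perm_mem perm_bots) mem_cat.
  rewrite -/B -/H /=; case xH: (x \in H); last by rewrite orbF => ->.
  by have /hasPn/(_ x xH) := dB.
rewrite sBE sHE sDE sGE -!rcons_cat; apply/eq_in_map => k k2n.
rewrite /fill -/(fill_bot n (mem D)) -/(fill_top n (mem B)).
have kb : k \in fill_bot n (mem D).
  by rewrite mem_cat !mem_filter k2n !andbT orbN.
rewrite -!cats1 index_cat kb nth_cat ifT //.
have size_filterC (T : Type) (a : pred T) s : size ([seq x <- s | a x] ++ [seq x <- s | ~~ a x]) = size s.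
  by rewrite size_cat !size_filter; apply: count_predC.
by rewrite size_filterC size_iota -[X in _ < X](size_iota 2) -(size_filterC _ (mem D)) index_mem.
Qed.
End Hat.

(** * Filling the two-row array *)

Lemma triple_free_map T (F : nat -> nat) s :
  sorted ltn s ->
  (forall i j k, i \in s -> j \in s -> k \in s -> i < j < k ->
     ~~ T (F i) (F j) (F k)) <->
  triple_free T (map F s).
Proof.
move=> ss; split=> [free|/triple_freeP free i j k si sj sk /andP[ij jk]].
  apply/triple_freeP => a b c /subseqP[m _]; rewrite -map_mask.
  have := mask_subseq m s; move: (mask m s) => t ts.
  have := subseq_sorted ltn_trans ts ss; have := mem_subseq ts.
  case: t {ts} => [|i [|j [|k [|? ?]]]] //= sub /and3P[ij jk _] [-> -> ->].
  by apply: free; rewrite ?ij // sub // !inE eqxx ?orbT.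
apply: free; rewrite -[[:: _; _; _]]/(map F [:: i; j; k]); apply: map_subseq.
(* Two strictly increasing words with the same letters coincide, and a filtered word is a
   subsequence. *)
have -> : [:: i; j; k] = [seq x <- s | x \in [:: i; j; k]].
  apply: (irr_sorted_eq ltn_trans ltnn) => [||x] /=.
  - by rewrite ij jk.
  - exact: sorted_filter ltn_trans _ _ ss.
  rewrite mem_filter; case xt: (x \in [:: i; j; k]) => //=.
  by move: xt; rewrite !inE => /or3P[] /eqP->; rewrite ?si ?sj ?sk.
exact: filter_subseq.
Qed.

(** If the entry of [w] were smaller, at least [i + 1] letters of [w] would lie below [nth 0 s i],
    against at most [i] letters of [s]. *)
Lemma nth_leq_of_count (s w : seq nat) i :
  sorted ltn s -> sorted ltn w -> size w = size s -> i < size s ->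
  count (fun y => y < nth 0 s i) w <= count (fun y => y < nth 0 s i) s ->
  nth 0 s i <= nth 0 w i.
Proof.
move=> ss sw wsz i_lt; apply: contraLR; rewrite -!ltnNge => wi.
have nth_mono (t : seq nat) j k : sorted ltn t -> j <= k < size t -> nth 0 t j <= nth 0 t k.
  move=> st /andP[jk kt]; have stl : sorted leq t by apply: sub_sorted st => x y /ltnW.
  by apply: (sorted_leq_nth leq_trans leqnn) => //; rewrite inE //; apply: leq_ltn_trans jk kt.
apply: (@leq_ltn_trans i).
  rewrite -{2}(cat_take_drop i s) count_cat.
  have -> : count (fun y => y < nth 0 s i) (drop i s) = 0.
    apply/eqP; rewrite eqn0Ngt -has_count -all_predC; apply/(all_nthP 0) => j.
    rewrite size_drop => j_lt; rewrite nth_drop /= -leqNgt; apply: nth_mono => //.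
    by rewrite leq_addr /= -ltn_subRL.
  by rewrite addn0 (leq_trans (count_size _ _)) // size_take i_lt.
rewrite -[X in _ < count _ X](cat_take_drop i.+1 w) count_cat ltn_addr //.
have -> : count (fun y => y < nth 0 s i) (take i.+1 w) = i.+1.
  rewrite -[RHS](_ : size (take i.+1 w) = _); last by rewrite size_takel // wsz.
  apply/eqP; rewrite -all_count; apply/(all_nthP 0) => j.
  rewrite size_takel ?wsz // => ji; rewrite nth_take //.
  by apply: leq_ltn_trans wi; apply: nth_mono; rewrite // wsz -ltnS ji.
exact: ltnSn.
Qed.

Section Fill.
Variables (n : nat) (D B : pred nat).

Lemma perm_fill_bot : perm_eq (fill_bot n D) (iota 2 n).
Proof. by rewrite perm_filterC. Qed.

Lemma perm_fill_top : perm_eq (fill_top n B) (iota 1 n).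
Proof. by rewrite perm_filterC. Qed.

(** Read along the bottom row instead of along the interval, the values of [fill] spell the top
    row. *)
Lemma perm_fill : perm_eq [seq fill n D B k | k <- iota 2 n] (iota 1 n).
Proof.
apply: (perm_trans _ perm_fill_top).
have <- : [seq fill n D B k | k <- fill_bot n D] = fill_top n B.
  have ub : uniq (fill_bot n D) by rewrite (perm_uniq perm_fill_bot) iota_uniq.
  have sz : size (fill_bot n D) = size (fill_top n B).
    by rewrite (perm_size perm_fill_bot) (perm_size perm_fill_top) !size_iota.
  apply: (@eq_from_nth _ 0); rewrite ?size_map // => i i_lt.
  by rewrite (nth_map 0) // /fill index_uniq.
by rewrite perm_map // perm_sym perm_fill_bot.
Qed.

Hypothesis countDB : count D (iota 2 n) = count B (iota 1 n).

Let sD := [seq k <- iota 2 n | D k].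
Let sG := [seq k <- iota 2 n | ~~ D k].
Let sB := [seq k <- iota 1 n | B k].
Let sH := [seq k <- iota 1 n | ~~ B k].

Lemma size_fill_desc : size sB = size sD.
Proof. by rewrite !size_filter. Qed.

Lemma size_fill_asc : size sH = size sG.
Proof.
have := count_predC D (iota 2 n); have := count_predC B (iota 1 n).
rewrite !size_filter !size_iota countDB => eB eD.
by apply: (@addnI (count B (iota 1 n))); rewrite [LHS]eB [RHS]eD.
Qed.

(** Equal counts make the left blocks of both rows equally long, so each column stays within the
    left blocks or within the right ones. *)
Lemma fillE k : k \in iota 2 n ->
  fill n D B k = if D k then nth 0 sB (index k sD) else nth 0 sH (index k sG).
Proof.
move=> kn; rewrite /fill /fill_top /fill_bot -/sD -/sG -/sB -/sH.
rewrite index_cat mem_filter kn andbT; case: ifP => Dk.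
  by rewrite nth_cat size_fill_desc index_mem mem_filter Dk kn.
by rewrite nth_cat size_fill_desc ifN ?addKn // -leqNgt leq_addr.
Qed.

Lemma fill_mono j k : j \in iota 2 n -> k \in iota 2 n -> D j = D k ->
  j < k -> fill n D B j < fill n D B k.
Proof.
have mono (s w : seq nat) : sorted ltn s -> sorted ltn w -> size w = size s ->
    j \in s -> k \in s -> j < k -> nth 0 w (index j s) < nth 0 w (index k s).
  move=> ss sw wsz js ks jk; apply: (sorted_ltn_nth ltn_trans) => //; rewrite ?inE ?wsz ?index_mem //.
  rewrite ltnNge; apply: contraL jk; rewrite -leqNgt leq_eqVlt => /predU1P[e|lt].
    by rewrite -(nth_index 0 js) -(nth_index 0 ks) e.
  rewrite ltnW // -(nth_index 0 js) -(nth_index 0 ks).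
  by apply: (sorted_ltn_nth ltn_trans); rewrite ?inE ?index_mem.
move=> jn kn Djk jk; rewrite !fillE // -Djk.
have filt a m p : sorted ltn [seq x <- iota a m | p x].
  by apply: sorted_filter; [apply: ltn_trans | apply: iota_ltn_sorted].
case: ifP => Dj; apply: mono; rewrite ?size_fill_desc ?size_fill_asc ?filt //;
  by rewrite mem_filter -?Djk Dj.
Qed.

(** Of three positions two agree on [D], and by [fill_mono] their values increase. *)
Lemma fill_free321 : triple_free is321 [seq fill n D B k | k <- iota 2 n].
Proof.
apply/triple_free_map => [|i j k ni nj nk /andP[ij jk]].
  exact: iota_ltn_sorted.
have := fill_mono ni nj; have := fill_mono nj nk; have := fill_mono ni nk.
rewrite /is321; case: (D i); case: (D j); case: (D k) => a b c;
by (have := a erefl (ltn_trans ij jk)) || (have := b erefl jk) || (have := c erefl ij); lia.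
Qed.

Lemma fill_desc_bot k : k \in iota 2 n -> B (fill n D B k) = D k.
Proof.
move=> kn; rewrite fillE //; case: ifP => Dk.
  have : nth 0 sB (index k sD) \in sB.
    by apply: mem_nth; rewrite size_fill_desc index_mem mem_filter Dk.
  by rewrite mem_filter => /andP[].
have : nth 0 sH (index k sG) \in sH.
  by apply: mem_nth; rewrite size_fill_asc index_mem mem_filter Dk.
by rewrite mem_filter => /andP[/negbTE].
Qed.
End Fill.

(* The difference of the two counts is the number of ascents crossing [x] from
   below; there is one if the first letter is below [x] and some other is not. *)
Lemma count_asc_lt x a (w : seq nat) :
  has (leq x) (a :: w) ->
  (a < x) + count (fun p => p.2 < x) (asc (a :: w))
    <= count (fun p => p.1 < x) (asc (a :: w)).
Proof.
have sub s : count (fun p => p.2 < x) (asc s) <= count (fun p => p.1 < x) (asc s).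
  rewrite /asc !count_filter; apply: sub_count => -[b c] /= /andP[cx bc].
  by rewrite bc (leq_ltn_trans bc cx).
elim: w a => [|b w IH] a /=; first by rewrite orbF leqNgt => /negbTE->.
have ascE : asc (a :: b :: w) = if a <= b then (a, b) :: asc (b :: w) else asc (b :: w).
  by rewrite /asc /=.
rewrite ascE; case: (ltnP a x) => [ax|xa _]; last first.
  by case: (leqP a b) => /= ab; [rewrite !ltnNge xa (leq_trans xa ab) | ]; exact: sub.
move=> /IH /=; case: (leqP a b) => /= ab; rewrite ?ax ?(ltn_trans ab ax) //.
Qed.

(** * Deficient positions of the array of a word *)

Section HatFill.
Variables (n : nat) (u : seq nat).
Hypothesis perm_u : perm_eq u (iota 2 n).
Let r := rcons u 1.
Let D := unzip1 (desc r).
Let B := unzip2 (desc r).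

Lemma perm_desc_tops : perm_eq [seq k <- iota 2 n | mem D k] D.
Proof.
have := uniq_tops perm_u; rewrite cat_uniq => /andP[uD _].
apply: uniq_perm; rewrite ?filter_uniq ?iota_uniq // => x.
rewrite mem_filter -(perm_mem perm_u).
by case: (boolP (x \in u)) => [|/(contra (@sub_desc_tops u x))/negbTE]; rewrite ?andbT //= -/D andbF.
Qed.

Lemma perm_desc_bots : perm_eq [seq k <- iota 1 n | mem B k] B.
Proof.
have := uniq_bots perm_u; rewrite cat_uniq => /andP[uB _].
apply: uniq_perm; rewrite ?filter_uniq ?iota_uniq // => x.
rewrite mem_filter.
by case: (boolP (x \in iota 1 n)) => [|/(contra (@desc_bots_leq_n _ _ perm_u x))/negbTE]; rewrite ?andbT //= -/B andbF.
Qed.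

Lemma count_desc : count (mem D) (iota 2 n) = count (mem B) (iota 1 n).
Proof.
by rewrite -!size_filter (perm_size perm_desc_tops) (perm_size perm_desc_bots) !size_map.
Qed.

(** Positions and values are compared rank by rank within each block; [nth_leq_of_count] reduces
    both comparisons to counting descents and ascents. *)
Lemma fill_lt k : k \in iota 2 n -> (fill n (mem D) (mem B) k < k) = (k \in D).
Proof.
move=> kn; rewrite (fillE count_desc) //.
set sD := [seq k <- iota 2 n | mem D k]; set sB := [seq k <- iota 1 n | mem B k].
set sG := [seq k <- iota 2 n | ~~ mem D k]; set sH := [seq k <- iota 1 n | ~~ mem B k].
have filt a m p : sorted ltn [seq x <- iota a m | p x].
  by apply: sorted_filter; [apply: ltn_trans | apply: iota_ltn_sorted].
case: ifP => [Dk|/negbT Dk].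
  rewrite [k \in D]Dk.
  have ksD : k \in sD by rewrite mem_filter Dk.
  have i_lt : index k sD < size sB by rewrite (size_fill_desc count_desc) index_mem.
  (* The map [S] absorbs the strict inequality. For the count, a descent whose top is at most the
     letter [b] introduced below has its bottom below [b]. *)
  rewrite -[X in _ < X](nth_index 0 ksD) -(nth_map 0 0 S) //.
  apply: nth_leq_of_count; rewrite ?size_map //.
  - by rewrite sorted_map; apply: filt.
  - exact: filt.
  - by rewrite (size_fill_desc count_desc).
  rewrite (nth_map 0) //; set b := nth 0 sB _; rewrite count_map.
  rewrite (permP perm_desc_tops) (permP perm_desc_bots) /D /B /desc !count_map !count_filter.
  by apply: sub_count => -[p q] /= /andP[pb qp]; rewrite qp andbT; lia.
have ksG : k \in sG by rewrite mem_filter Dk.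
have -> : (k \in D) = false by apply: negbTE.
apply/negbTE; rewrite -leqNgt -{1}(nth_index 0 ksG).
apply: nth_leq_of_count; rewrite ?filt ?index_mem ?(size_fill_asc count_desc) //.
rewrite nth_index //.
have kn1 : k \in iota 1 n.+1 by move: kn; rewrite !mem_iota; lia.
have eG : count (fun y => y < k) sG = count (fun y => y < k) (unzip1 (asc r)).
  apply: (@addnI (count (fun y => y < k) D)).
  rewrite -{1}(permP perm_desc_tops) -!count_cat (permP (perm_fill_bot n (mem D))).
  by rewrite (permP (perm_tops u)) (permP perm_u).
(* The word also contains [n.+1], absent from [sH], but [k <= n.+1] keeps it out of the count. *)
have eH : count (fun y => y < k) sH = (head 1 r < k) + count (fun y => y < k) (unzip2 (asc r)).
  apply: (@addnI (count (fun y => y < k) B)).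
  rewrite -{1}(permP perm_desc_bots) -!count_cat (permP (perm_fill_top n (mem B))).
  rewrite -[RHS]/(_ + count _ (head 1 r :: _)) -count_cat.
  rewrite (permP (perm_bots u)) (permP (perm_r perm_u)) iota_rcons -cats1 count_cat /=.
  by move: kn; rewrite mem_iota; lia.
rewrite eG eH !count_map.
have rE : r = head 1 r :: behead r by rewrite /r; case: (u).
rewrite rE; apply: count_asc_lt; rewrite -rE; apply/hasP; exists k => //.
by rewrite (perm_mem (perm_r perm_u)).
Qed.
End HatFill.

(** * Injectivity *)

(** By [fill_lt] the descent tops are the positions [k] with value below [k], and by [fill_desc_bot]
    the descent bottoms are the values there. *)
Lemma fill_desc_inj n u1 u2 :
  perm_eq u1 (iota 2 n) -> perm_eq u2 (iota 2 n) ->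
  let F u := fill n (mem (unzip1 (desc (rcons u 1)))) (mem (unzip2 (desc (rcons u 1)))) in
  [seq F u1 k | k <- iota 2 n] = [seq F u2 k | k <- iota 2 n] ->
  unzip1 (desc (rcons u1 1)) =i unzip1 (desc (rcons u2 1)) /\
  unzip2 (desc (rcons u1 1)) =i unzip2 (desc (rcons u2 1)).
Proof.
move=> p1 p2 F /eq_in_map eqF.
have eqD k : k \in iota 2 n ->
    (k \in unzip1 (desc (rcons u1 1))) = (k \in unzip1 (desc (rcons u2 1))).
  by move=> kn; rewrite -(fill_lt p1 kn) -(fill_lt p2 kn) -/(F u1) -/(F u2) eqF.
split=> [k|b].
  case: (boolP (k \in iota 2 n)) => [|kn]; first exact: eqD.
  have out u : perm_eq u (iota 2 n) -> (k \in unzip1 (desc (rcons u 1))) = false.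
    by move=> pu; apply: contraNF kn; rewrite -(perm_mem pu); apply: sub_desc_tops.
  by rewrite !out.
case: (boolP (b \in iota 1 n)) => [|bn]; last first.
  have out u : perm_eq u (iota 2 n) -> (b \in unzip2 (desc (rcons u 1))) = false.
    by move=> pu; apply: contraNF bn; apply: desc_bots_leq_n.
  by rewrite !out.
rewrite -(perm_mem (perm_fill n (mem (unzip1 (desc (rcons u1 1))))
  (mem (unzip2 (desc (rcons u1 1)))))) => /mapP[k kn ->].
have bot u (pu : perm_eq u (iota 2 n)) :
    (F u k \in unzip2 (desc (rcons u 1))) = (k \in unzip1 (desc (rcons u 1))).
  exact: (fill_desc_bot (count_desc pu) kn).
by rewrite -/(F u1) [LHS](bot _ p1) eqF // (bot _ p2) eqD.
Qed.

Lemma uniq_map_inj (T1 T2 : eqType) (f : T1 -> T2) s :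
  uniq (map f s) -> {in s &, injective f}.
Proof.
elim: s => //= x s IH /andP[xs us] p q; rewrite !inE.
move=> /predU1P[->|ps] /predU1P[->|qs] // e; last exact: IH.
  by case/negP: xs; rewrite e map_f.
by case/negP: xs; rewrite -e map_f.
Qed.

(** Without repetition a letter starts at most one adjacent pair and ends at most one, so the
    displayed pair decides. *)
Lemma mem_desc (X Y : seq nat) a b : uniq (X ++ a :: b :: Y) ->
  (a \in unzip1 (desc (X ++ a :: b :: Y))) = (b < a) /\
  (b \in unzip2 (desc (X ++ a :: b :: Y))) = (b < a).
Proof.
set r := _ ++ _ => ur; have ab : (a, b) \in adj r by apply/adjP; exists X, Y.
have u1 : uniq (unzip1 (adj r)).
  by case: (r) ur => // x r'; rewrite unzip1_adj lastI rcons_uniq => /andP[].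
have u2 : uniq (unzip2 (adj r)).
  by rewrite unzip2_adj; case: (r) ur => // x r' /andP[].
split; apply/mapP/idP => [[[a' b']]|ba].
- rewrite mem_filter => /andP[/= ba' ab'] e; rewrite -{}e in ba' ab'.
  by have [->] := uniq_map_inj u1 ab ab' erefl.
- by exists (a, b); rewrite // mem_filter ba.
- rewrite mem_filter => /andP[/= ba' ab'] e; rewrite -{}e in ba' ab'.
  by have [->] := uniq_map_inj u2 ab ab' erefl.
by exists (a, b); rewrite // mem_filter ba.
Qed.

(* The letters in front of a common suffix [y :: w]: descent tops are
   right-to-left maxima, and before an ascent top [y] comes the largest letter
   below [y] that is not used in [y :: w]. *)
Lemma desc_last_geq (A1 A2 : seq nat) a1 a2 y w :
  let r1 := A1 ++ a1 :: y :: w in let r2 := A2 ++ a2 :: y :: w in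
  uniq r1 -> uniq r2 -> triple_free is213 r1 -> triple_free is213 r2 ->
  unzip1 (desc r1) =i unzip1 (desc r2) -> unzip2 (desc r1) =i unzip2 (desc r2) ->
  a1 \in A2 -> a2 \in A1 -> a2 <= a1.
Proof.
move=> r1 r2 u1 u2 /triple_freeP f1 /triple_freeP f2 eD eB a1A2 a2A1.
rewrite leqNgt; apply/negP => a12.
have [a1D yB1] := mem_desc u1; have [_ yB2] := mem_desc u2.
have ya : (y < a1) = (y < a2) by rewrite -yB1 -yB2 eB.
case: (ltnP y a1) => [ya1|a1y].
  have a1D2 : a1 \in unzip1 (desc r2) by rewrite -eD a1D.
  (* In [r2] the descent top [a1] stands before [a2]; its successor [b] and then [a2] complete a
     pattern 213. *)
  have [b [X [Z [r2E a2Z]]]] : exists b X Z, r2 = X ++ a1 :: b :: Z /\ a2 \in b :: Z.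
    case/splitPr: a1A2 @r2 {u2 f2 eD eB yB2 a1D2} => X [|b Z] /=; rewrite -catA.
      by exists a2, X, (y :: w); rewrite mem_head.
    exists b, X, (Z ++ a2 :: y :: w); rewrite inE mem_cat mem_head !orbT; split=> //.
  move: u2 a1D2; rewrite r2E => u2; have [-> _ ba1] := mem_desc u2.
  have := f2 a1 b a2; rewrite /is213 ba1 a12 => /(_ _)/negP; case=> //.
  rewrite r2E; apply: subseq_trans (suffix_subseq _ _) => /=.
  rewrite !eqxx sub1seq; move: a2Z; rewrite inE => /predU1P[e|//].
  by move: ba1; rewrite -e ltnNge ltnW.
have a2y : a2 < y.
  rewrite ltn_neqAle leqNgt -ya -leqNgt a1y andbT.
  move: u1; rewrite /r1 cat_uniq /= => /and3P[_ /norP[_ /norP[yA1 _]] _].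
  by apply: contraNneq yA1 => <-.
have := f1 a2 a1 y; rewrite /is213 a12 a2y => /(_ _)/negP; case=> //.
rewrite -[[:: a2; a1; y]]/([:: a2] ++ [:: a1; y]); apply: cat_subseq.
  by rewrite sub1seq.
by rewrite /= !eqxx sub0seq.
Qed.

(** The words [r1] and [r2] stay fixed while the common suffix [y :: w] grows to the left;
    [desc_last_geq], used in both directions, identifies the next letters. *)
Lemma free213_determined r1 r2 :
  uniq r1 -> uniq r2 -> triple_free is213 r1 -> triple_free is213 r2 ->
  unzip1 (desc r1) =i unzip1 (desc r2) -> unzip2 (desc r1) =i unzip2 (desc r2) ->
  forall A1 A2 y w, r1 = A1 ++ y :: w -> r2 = A2 ++ y :: w -> perm_eq A1 A2 ->
  A1 = A2.
Proof.
move=> u1 u2 f1 f2 eD eB; elim/last_ind => [|A1 a1 IH] A2 y w.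
  by move=> _ _; rewrite perm_sym => /perm_nilP.
case/lastP: A2 => [|A2 a2]; first by move=> _ _ /perm_nilP.
move=> e1 e2 pA; have := perm_mem pA => mA.
rewrite cat_rcons in e1; rewrite cat_rcons in e2.
have e12 : a1 = a2.
  apply/eqP/negP => /negP a12.
  have a1A2 : a1 \in A2.
    by have := mA a1; rewrite !mem_rcons !inE eqxx (negbTE a12) => /= <-.
  have a2A1 : a2 \in A1.
    by have := mA a2; rewrite !mem_rcons !inE eqxx eq_sym (negbTE a12) => /= ->.
  case/eqP: a12; apply/eqP; rewrite eqn_leq; subst r1 r2.
  by rewrite (desc_last_geq u2 u1) // (desc_last_geq u1 u2).
subst a2; rewrite (IH A2 _ _ e1 e2) //.
by move: pA; rewrite perm_rcons perm_sym perm_rcons perm_cons perm_sym.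
Qed.

(** * Words with prescribed descent tops and bottoms *)

Lemma split_last_has (T : Type) (a : pred T) s : has a s ->
  exists s1 x s2, [/\ s = s1 ++ x :: s2, a x & all (predC a) s2].
Proof.
elim: s => //= x s IH; case: (boolP (has a s)) => [/IH[s1 [y [s2 [-> ay as2]]]] _|].
  by exists (x :: s1), y, s2.
by rewrite -all_predC orbF => as2 ax; exists [::], x, s.
Qed.

Definition above (c1 c2 : seq nat) := allrel (fun x y => y < x) c1 c2.

Lemma above_flatten c st : all (above c) st -> above c (flatten st).
Proof.
elim: st => [|c' st IH] /=; first by rewrite /above allrel0r.
by case/andP=> cc' /IH; rewrite /above allrel_catr => ->; rewrite andbT.
Qed.

(** The outer letters of a pattern 213 increase, so both lie on the same side of the cut, and the
    middle one with them. *)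
Lemma free213_cat c1 c2 : above c1 c2 ->
  triple_free is213 c1 -> triple_free is213 c2 -> triple_free is213 (c1 ++ c2).
Proof.
elim: c1 => //= x c1 IH; rewrite /above allrel_consl => /andP[/allP xc2 c12].
case/andP=> pw f1 f2; rewrite IH // andbT pairwise_cat pw /=; apply/andP; split.
  apply/allrelP => y z _ /xc2; rewrite /is213; lia.
apply/(pairwiseP 0) => i j _ jc2 _; apply/negP => /andP[_ lt].
by have := ltn_trans lt (xc2 _ (mem_nth 0 jc2)); rewrite ltnn.
Qed.

(* The letters are inserted from the largest to the smallest, the current word
   being kept as the list of its skew components.  A letter prescribed as a
   descent top becomes a new last component; a letter prescribed as an ascent
   bottom goes right before the last component headed by a prescribed ascent
   top, and swallows everything after it. *)
Section Insertion.
Variables g h : pred nat.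

(** [g] prescribes the letters left by an ascent and [h] those entered by an ascent; their
    complements are left and entered by descents. *)
Definition link a b := if a < b then g a && h b else [&& b < a, ~~ g a & ~~ h b].

(** Ending outside [g] allows a component to be followed by smaller letters. *)
Definition component c :=
  [&& c != [::], triple_free is213 c, sorted link c & ~~ g (last 0 c)].

Lemma component_cat c1 c2 : component c1 -> component c2 -> above c1 c2 ->
  ~~ h (head 0 c2) -> component (c1 ++ c2).
Proof.
case: c1 => // x1 c1; case: c2 => // x2 c2.
move=> /and4P[_ f1 s1 g1] /and4P[_ f2 s2 g2] c12 hx2.
apply/and4P; split=> //.
- exact: free213_cat.
- rewrite /= cat_path; move: s1 s2 => /= -> -> /=; rewrite andbT.
  have lt21 : x2 < last x1 c1.
    by move/allrelP: c12; apply; rewrite ?mem_last ?mem_head.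
  by rewrite /link ltnNge ltnW //= lt21 hx2 andbT.
by rewrite last_cat.
Qed.

Lemma component_flatten c st : all component (c :: st) -> pairwise above (c :: st) ->
  all (fun c => ~~ h (head 0 c)) st -> component (c ++ flatten st).
Proof.
elim: st c => [|c' st IH] c; first by rewrite /= cats0 andbT.
rewrite [all _ (c :: _)]/= [pairwise _ (c :: _)]/= [all _ (c' :: _)]/=.
move=> /andP[cc cst] /andP[/andP[cc' abst] pst] /andP[hc' hst].
apply: component_cat => //; first exact: IH.
  by rewrite /above allrel_catr; apply/andP; split=> //; apply: above_flatten.
by case: (c') cst hc' => // /andP[].
Qed.

Lemma component_cons v c : component c -> {in c, forall x, v < x} ->
  g v -> h (head 0 c) -> component (v :: c).
Proof.
case: c => // x c /and4P[_ f s gl] vc gv hx; apply/and4P; split=> //.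
  apply/andP; split=> //; apply/(pairwiseP 0) => i j ic _ _.
  by apply/negP => /andP[lt _]; have := ltn_trans lt (vc _ (mem_nth 0 ic)); rewrite ltnn.
by move: s; rewrite /= /link => ->; rewrite vc ?mem_head // gv [h x]hx.
Qed.

(** A component headed in [h] can still be preceded by an ascent bottom; the equality counts these
    components, and the strict inequalities provide one whenever a letter of [g] arrives. The last
    clause is there because the finished word must begin in [h]. *)
Lemma stack_exists n d : 0 < d <= n ->
  (forall d', 0 < d' <= n ->
     count g (iota (n.+2 - d') d') < count h (iota (n.+2 - d') d')) ->
  exists st, [/\ perm_eq (flatten st) (iota (n.+2 - d) d), all component st,
    pairwise above st,
    count (fun c => h (head 0 c)) st + count g (iota (n.+2 - d) d)
      = count h (iota (n.+2 - d) d)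
    & h (head 0 (head [::] st))].
Proof.
move=> dn lt_gh; elim: d dn => // [[_ n_gt0|d IH /andP[_ dn]]].
  (* For [d = 1] the inequality forces [n.+1] into [h] and out of [g]. *)
  exists [:: [:: n.+1]]; have := lt_gh 1 n_gt0.
  rewrite subSS subn0 /component /=.
  by case: (g n.+1) (h n.+1) => -[]; split.
have [|st [pst cst ast cnt hst]] := IH; first by apply: ltnW.
have [v vE [vE2 v_gt0]] : exists2 v, n.+2 - d.+2 = v & n.+2 - d.+1 = v.+1 /\ v + d.+2 = n.+2.
  by exists (n.+2 - d.+2) => //; lia.
have := lt_gh d.+2 dn; rewrite vE; rewrite {}vE2 in pst cnt.
rewrite -[iota v d.+2]/(v :: iota v.+1 d.+1).
move: (iota v.+1 d.+1) (mem_iota v.+1 d.+1) pst cnt => L memL pst cnt lt_v.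
have v_lt : {in flatten st, forall x, v < x}.
  by move=> x; rewrite (perm_mem pst) memL => /andP[].
have st_gt c : c \in st -> above c [:: v].
  move=> c_st; rewrite /above allrel1r; apply/allP => x xc; apply: v_lt.
  by apply/flattenP; exists c.
case: (boolP (g v)) => [gv|gv].
- have : has (fun c => h (head 0 c)) st.
    rewrite has_count; move: lt_v cnt => /=; rewrite gv.
    by case: (h v); lia.
  (* Behind the last such component all heads lie outside [h], so [component_flatten] glues what
     follows to it by descents. *)
  case/split_last_has => st1 [c [st2 [stE hc hst2]]]; subst st.
  exists (rcons st1 (v :: c ++ flatten st2)).
  move: cst; rewrite all_cat => /andP[cst1 cst2].
  move: ast; rewrite pairwise_cat => /and3P[/allrelP ab ast1 ast2].
  have cnt2 : count (fun c => h (head 0 c)) st2 = 0.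
    by apply/eqP; rewrite eqn0Ngt -has_count -all_predC.
  have c_nil : c != [::] by case/andP: cst2 => /andP[].
  have new_cnt : count (fun c => h (head 0 c)) (rcons st1 (v :: c ++ flatten st2))
      + count g (v :: L) = count h (v :: L).
    rewrite -cats1 count_cat /= gv -cnt count_cat /= hc cnt2; lia.
  split=> //.
  + rewrite -cats1 flatten_cat /= cats0 -cat1s perm_catCA /= perm_cons.
    by move: pst; rewrite flatten_cat.
  + rewrite all_rcons cst1 andbT; apply: component_cons => //.
    * exact: component_flatten.
    * by move=> x xc; apply: v_lt; rewrite flatten_cat mem_cat /= xc orbT.
    by case: (c) c_nil hc.
  + rewrite pairwise_rcons ast1 andbT; apply/allP => c0 c0st1.
    have := st_gt c0; rewrite mem_cat c0st1 /above allrel1r allrel_consr => -> //=.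
    apply: (@above_flatten c0 (c :: st2)).
    by apply/allP => c1 c1st; apply: ab.
  (* If [st1] is empty, the merged component is the only one, and the strict inequality at [v]
     forces [h v]. *)
  case: st1 {cst1 ab ast1 ast2 pst cnt v_lt st_gt} hst new_cnt => //= _ new_cnt.
  by move: lt_v new_cnt; rewrite /= gv; case: (h v); lia.
exists (rcons st [:: v]); split.
- by rewrite -cats1 flatten_cat /= perm_catC /= perm_cons.
- by rewrite all_rcons cst andbT /component /= gv.
- by rewrite pairwise_rcons ast andbT; apply/allP.
- by rewrite -cats1 count_cat /= (negbTE gv) -cnt; lia.
case: st {cst ast cnt v_lt st_gt} pst hst => // /perm_size/esym/size0nil L0 _.
by have := memL v.+1; rewrite L0 in_nil leqnn addnS ltnS leq_addr.
Qed.

(** At [d = n] the surplus of one leaves the first component as the only one headed in [h], so all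
    components glue into one; the final [1], outside [h], is reached by a descent. *)
Lemma link_exists n :
  (forall d, 0 < d <= n ->
     count g (iota (n.+2 - d) d) < count h (iota (n.+2 - d) d)) ->
  0 < n -> count h (iota 2 n) = (count g (iota 2 n)).+1 -> ~~ h 1 ->
  exists u, [/\ perm_eq u (iota 2 n), triple_free is213 (rcons u 1),
    sorted link (rcons u 1) & h (head 1 (rcons u 1))].
Proof.
move=> lt_gh n_gt0 eq_gh h1; have [|st] := @stack_exists n n _ lt_gh.
  by rewrite n_gt0 leqnn.
have -> : n.+2 - n = 2 by lia.
rewrite eq_gh; case=> pst cst ast cnt hst.
have {}cnt : count (fun c => h (head 0 c)) st = 1 by lia.
have : component (flatten st).
  case: st {pst} cst ast cnt hst => // c st cst ast /= cnt hc; apply: component_flatten => //.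
  rewrite all_predC has_count; move: cnt; rewrite hc; lia.
move=> comp; set u := flatten st in pst comp *.
have u_gt1 : {in u, forall x, 1 < x} by move=> x; rewrite (perm_mem pst) mem_iota => /andP[].
exists u; split=> //.
- rewrite -cats1; apply: free213_cat => //; last by case/and4P: comp.
  by rewrite /above allrel1r; apply/allP.
- case: (u) comp u_gt1 => // x w /and4P[_ _ s gl] w_gt.
  rewrite /= rcons_path; move: s gl => /= -> gl /=.
  have lt := w_gt _ (mem_last x w).
  by rewrite /link ltnNge (ltnW lt) /= lt gl.
move: hst comp; rewrite /u; case: (st) cst => //= c st' /andP[+ _].
by case: c.
Qed.
End Insertion.

Lemma sorted_adj (e : rel nat) r a b : sorted e r -> (a, b) \in adj r -> e a b.
Proof.
move=> sr /adjP[X [Y rE]]; move: sr; rewrite rE.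
case: X {rE} => [/andP[]//|x X]; rewrite /= cat_path.
by case/and4P.
Qed.

(** Every letter of [u] has a successor in [r], and every letter of [r] but the first has a
    predecessor; [link] ties the direction of that step to [g] and [h]. The first letter is no
    descent bottom and lies in [h]. *)
Lemma mem_link_desc g h u :
  let r := rcons u 1 in sorted (link g h) r -> h (head 1 r) ->
  {in u, forall k, (k \in unzip1 (desc r)) = ~~ g k} /\
  {in r, forall b, (b \in unzip2 (desc r)) = ~~ h b}.
Proof.
move=> r sr hr; split=> [k ku|b br]; apply/mapP/idP => [[[a c]]|].
- rewrite mem_filter => /andP[/= ca /(sorted_adj sr)] + ->.
  by rewrite /link ltnNge ltnW //= => /and3P[].
- move=> gk; move: ku; rewrite -(unzip1_adj_rcons u 1) => /mapP[[a c] ac /= e].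
  exists (a, c) => //; rewrite mem_filter ac andbT /=; have := sorted_adj sr ac.
  by rewrite /link -e (negbTE gk) /=; case: ifP => // _ /andP[].
- rewrite mem_filter => /andP[/= ca /(sorted_adj sr)] + ->.
  by rewrite /link ltnNge ltnW //= => /and3P[].
move=> hb; have : b \in behead r.
  have : r = head 1 r :: behead r by rewrite /r; case: (u).
  move=> rE; move: br; rewrite {1}rE inE => /predU1P[e|//].
  by rewrite e hr in hb.
rewrite -unzip2_adj => /mapP[[a c] ac /= e].
exists (a, c) => //; rewrite mem_filter ac andbT /=; have := sorted_adj sr ac.
by rewrite /link -e (negbTE hb) andbF /=; case: ifP => // _ /andP[].
Qed.

(** * Deficiencies of a 321-avoiding permutation *)

Lemma count_iota_ge (p : pred nat) a m v : a <= v <= a + m ->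
  count (fun k => (v <= k) && p k) (iota a m) = count p (iota v (a + m - v)).
Proof.
move=> avm; have -> : iota a m = iota a (v - a) ++ iota v (a + m - v).
  have {2}-> : v = a + (v - a) by lia.
  by rewrite -iotaD; congr iota; lia.
rewrite count_cat [X in X + _](_ : _ = 0) ?add0n; last first.
  apply/eqP; rewrite eqn0Ngt -has_count; apply/hasPn => k.
  by rewrite mem_iota => kv; rewrite leqNgt; have -> : k < v by lia.
by apply: eq_in_count => k; rewrite mem_iota => /andP[->].
Qed.

Section Deficiency.
Variables (n : nat) (T : nat -> nat).
Hypothesis perm_T : perm_eq [seq T k | k <- iota 2 n] (iota 1 n).

(** Positions start at [2], as in the array: [T k] is the letter number [k.-1] of the permutation,
    so [T k < k] means that there is no excedance there. *)
Definition deficient k := T k < k.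
Definition deficient_value b := has (fun k => deficient k && (T k == b)) (iota 2 n).

Lemma T_bounds k : 1 < k -> k < n.+2 -> 0 < T k <= n.
Proof.
move=> k1 kn; have : T k \in iota 1 n.
  by rewrite -(perm_mem perm_T); apply: map_f; rewrite mem_iota k1.
by rewrite mem_iota.
Qed.

Lemma T_inj : {in iota 2 n &, injective T}.
Proof. by apply: uniq_map_inj; rewrite (perm_uniq perm_T) iota_uniq. Qed.

Lemma deficient_valueE k : k \in iota 2 n -> deficient_value (T k) = deficient k.
Proof.
move=> kn; apply/hasP/idP => [[j jn /andP[dj /eqP/T_inj e]]|dk].
  by rewrite -e.
by exists k; rewrite // dk eqxx.
Qed.

(** [n.+1] is never a value of [T] and accounts for the successor; every other letter counted is
    [T k] for one nondeficient [k]. *)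
Lemma count_deficient_value v : 0 < v <= n.+1 ->
  count (predC deficient_value) (iota v (n.+2 - v))
  = (count (fun k => (v <= T k) && ~~ deficient k) (iota 2 n)).+1.
Proof.
move=> vn; have -> : n.+2 - v = (n.+1 - v).+1 by lia.
rewrite iota_rcons -cats1 count_cat /= subnKC; last by lia.
have -> : ~~ deficient_value n.+1.
  apply/hasPn => k kn; rewrite negb_and orbC; apply/orP; left; apply/eqP => e.
  have : T k \in iota 1 n by rewrite -(perm_mem perm_T) map_f.
  by rewrite e mem_iota; lia.
rewrite addn1 -[n.+1]add1n -count_iota_ge; last by lia.
rewrite -(permP perm_T) count_map; congr _.+1; apply: eq_in_count => k kn /=.
by rewrite deficient_valueE.
Qed.

(** A nondeficient [k] has [T k >= k], so if [k] lies in the final interval its value is at least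
    the left end; the extra letter [n.+1] makes the inequality strict. *)
Lemma count_deficient d : 0 < d <= n ->
  count (predC deficient) (iota (n.+2 - d) d)
    < count (predC deficient_value) (iota (n.+2 - d) d).
Proof.
move=> dn; have dE : d = n.+2 - (n.+2 - d) by lia.
rewrite {2 4}dE count_deficient_value; last by lia.
rewrite ltnS -[n.+2]/(2 + n) -count_iota_ge; last by lia.
apply: sub_count => k /= /andP[vk dk]; rewrite dk andbT.
by move: dk; rewrite /deficient; lia.
Qed.

Lemma count_deficient_all : 0 < n ->
  count (predC deficient_value) (iota 2 n) = (count (predC deficient) (iota 2 n)).+1.
Proof.
move=> n_gt0; have := @count_deficient_value 2; rewrite !subSS subn0 => -> //.
congr _.+1; apply: eq_in_count => k; rewrite mem_iota /deficient /= => kn.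
have : 0 < T k <= n by apply: T_bounds; lia.
by case: (ltnP (T k) k); rewrite ?andbF ?andbT //; lia.
Qed.

Lemma deficient_value1 : 0 < n -> deficient_value 1.
Proof.
move=> n_gt0; have : 1 \in iota 1 n by rewrite mem_iota; lia.
rewrite -(perm_mem perm_T) => /mapP[k kn e]; apply/hasP; exists k => //.
by rewrite -e eqxx andbT /deficient -e; move: kn; rewrite mem_iota => /andP[].
Qed.

Hypothesis free_T : triple_free is321 [seq T k | k <- iota 2 n].

Lemma T_free i j k : 1 < i -> i < j -> j < k -> k < n.+2 -> T k < T j -> T j < T i -> False.
Proof.
move=> i1 ij jk kn Tkj Tji.
have /triple_free_map free := free_T; have := free (iota_ltn_sorted _ _) i j k.
rewrite /is321 Tkj Tji ij jk !mem_iota /= i1 => /(_ _ _ _ isT)/negP; apply=> //; lia.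
Qed.

(* If a letter [T j] with [i < j] were smaller than [T i], too few values would
   be left below [T i] (resp. above [T j]), which forces a pattern 321. *)
Lemma deficient_mono i j : 1 < i -> i < j -> j < n.+2 ->
  deficient i = deficient j -> T i < T j.
Proof.
move=> i1 ij jn; rewrite /deficient ltnNge => def_ij.
rewrite ltnNge; apply/negP; rewrite leq_eqVlt => /predU1P[/T_inj e|Tji].
  have : j = i by apply: e; rewrite mem_iota; lia.
  by lia.
have bi : 0 < T i <= n by apply: T_bounds; lia.
have bj : 0 < T j <= n by apply: T_bounds; lia.
have inj_sub s : uniq s -> {subset s <= iota 2 n} -> uniq (map T s).
  move=> us sub; rewrite map_inj_in_uniq // => p q ps qs; apply: T_inj; exact: sub.
case: (leqP i (T i)) def_ij => Ti /= /esym; last first.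
  move=> Tj; have : size (map T (j :: iota 2 (i - 2))) <= size (iota 1 (T i).-1).
    apply: uniq_leq_size.
      apply: inj_sub => [|p] /=; first by rewrite iota_uniq mem_iota; lia.
      by rewrite inE !mem_iota => /predU1P[->|]; lia.
    move=> _ /mapP[p pL ->]; rewrite mem_iota.
    move: pL; rewrite inE mem_iota => /predU1P[->|pi]; first by lia.
    have bp : 0 < T p <= n by apply: T_bounds; lia.
    have Tpi : T p != T i.
      apply/eqP => /T_inj e; have : p = i by apply: e; rewrite mem_iota; lia.
      by lia.
    have := @T_free p i j; lia.
  rewrite size_map /= !size_iota; lia.
move=> /negbT; rewrite -leqNgt => Tj.
have : size (map T (i :: iota j.+1 (n.+1 - j))) <= size (iota (T j).+1 (n - T j)).
  apply: uniq_leq_size.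
    apply: inj_sub => [|p] /=; first by rewrite iota_uniq mem_iota; lia.
    by rewrite inE !mem_iota => /predU1P[->|]; lia.
  move=> _ /mapP[p pL ->]; rewrite mem_iota.
  move: pL; rewrite inE mem_iota => /predU1P[->|pj]; first by lia.
  have bp : 0 < T p <= n by apply: T_bounds; lia.
  have Tpj : T p != T j.
    apply/eqP => /T_inj e; have : p = j by apply: e; rewrite mem_iota; lia.
    by lia.
  have := @T_free i j p; lia.
rewrite size_map /= !size_iota; lia.
Qed.

(** By [deficient_mono], [T] increases on each class, so listing its values by position lists them
    in order. The flag [d] covers both classes. *)
Lemma deficient_sorted (d : bool) :
  [seq b <- iota 1 n | deficient_value b == d]
  = [seq T k | k <- [seq k <- iota 2 n | deficient k == d]].
Proof.
have ss : sorted ltn [seq k <- iota 2 n | deficient k == d].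
  by apply: sorted_filter; [apply: ltn_trans | apply: iota_ltn_sorted].
apply: (irr_sorted_eq ltn_trans ltnn).
- by apply: sorted_filter; [apply: ltn_trans | apply: iota_ltn_sorted].
- apply: (homo_sorted_in (P := mem [seq k <- iota 2 n | deficient k == d])) ss; last exact/allP.
  move=> i j; rewrite !mem_filter !mem_iota => /andP[/eqP di ni] /andP[/eqP dj nj] ij.
  by apply: deficient_mono; rewrite ?di ?dj //; lia.
move=> b; rewrite mem_filter; apply/andP/mapP => [[db]|[k]].
  rewrite -(perm_mem perm_T) => /mapP[k kn bE]; exists k => //.
  by rewrite mem_filter kn -deficient_valueE // -bE db.
rewrite mem_filter => /andP[dk kn] ->; rewrite deficient_valueE // dk.
by rewrite -(perm_mem perm_T) map_f.
Qed.

Lemma deficient_sortedT :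
  [seq b <- iota 1 n | deficient_value b]
  = [seq T k | k <- [seq k <- iota 2 n | deficient k]].
Proof.
have := deficient_sorted true.
by under eq_filter do rewrite eqb_id; under [in RHS]eq_filter do rewrite eqb_id.
Qed.

Lemma deficient_sortedF :
  [seq b <- iota 1 n | ~~ deficient_value b]
  = [seq T k | k <- [seq k <- iota 2 n | ~~ deficient k]].
Proof.
have := deficient_sorted false.
by under eq_filter do rewrite eqbF_neg; under [in RHS]eq_filter do rewrite eqbF_neg.
Qed.

(** [fill] matches sorted positions with sorted values in each class, just as [T] does. *)
Lemma fill_deficient k : k \in iota 2 n -> fill n deficient deficient_value k = T k.
Proof.
move=> kn; have cnt : count deficient (iota 2 n) = count deficient_value (iota 1 n).
  by rewrite -!size_filter deficient_sortedT size_map.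
rewrite fillE // deficient_sortedT deficient_sortedF.
have nth_T s : k \in s -> nth 0 [seq T k | k <- s] (index k s) = T k.
  by move=> ks; rewrite (nth_map 0) ?index_mem // nth_index.
by case: ifP => dk; apply: nth_T; rewrite mem_filter dk.
Qed.
End Deficiency.

(** * The bijection *)

Lemma triple_free_map_S s : triple_free is213 (map S s) = triple_free is213 s.
Proof. by elim: s => //= x s ->; rewrite pairwise_map. Qed.

Lemma free213_rcons1 u : {in u, forall x, 1 < x} ->
  triple_free is213 (rcons u 1) = triple_free is213 u.
Proof.
move=> u1; apply/idP/idP => f.
  by apply: triple_free_subseq f; apply: subseq_rcons.
rewrite -cats1; apply: free213_cat => //.
by rewrite /above allrel1r; apply/allP.
Qed.

Lemma hat_props n s : is_permn n s -> avoids s [:: 2; 1; 3] ->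
  perm_eq (map S s) (iota 2 n) /\ triple_free is213 (rcons (map S s) 1).
Proof.
move=> ps /avoids213P f; have pu : perm_eq (map S s) (iota 2 n).
  by rewrite -[2]/(1 + 1) iotaDl; apply: perm_map.
split=> //; rewrite free213_rcons1 ?triple_free_map_S // => x.
by rewrite (perm_mem pu) mem_iota => /andP[].
Qed.

Lemma eq_fill n (D D' B B' : pred nat) k :
  {in iota 2 n, D =1 D'} -> {in iota 1 n, B =1 B'} -> fill n D B k = fill n D' B' k.
Proof.
move=> eD eB; rewrite /fill /fill_top /fill_bot.
rewrite (eq_in_filter eD) (eq_in_filter eB).
by congr (nth 0 (_ ++ _) (index k (_ ++ _))); apply: eq_in_filter => x xn;
  rewrite ?eD ?eB.
Qed.

Theorem theorem2p12 (n : nat) (hn : 1 <= n) :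
  (forall s, is_permn n s -> avoids s [:: 2; 1; 3] ->
     is_permn n (Psi s) /\ avoids (Psi s) [:: 3; 2; 1]) /\
  (forall s1 s2, is_permn n s1 -> avoids s1 [:: 2; 1; 3] ->
     is_permn n s2 -> avoids s2 [:: 2; 1; 3] ->
     Psi s1 = Psi s2 -> s1 = s2) /\
  (forall t, is_permn n t -> avoids t [:: 3; 2; 1] ->
     exists s, [/\ is_permn n s, avoids s [:: 2; 1; 3] & Psi s = t]).
Proof.
split; [|split].
- move=> s ps /(hat_props ps)[pu f]; rewrite /Psi /sigma_hat (behead_PhiE pu) //.
  split; first exact: perm_fill.
  by apply/avoids321P; apply: fill_free321; apply: count_desc.
- move=> s1 s2 p1 /(hat_props p1)[pu1 f1] p2 /(hat_props p2)[pu2 f2].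
  rewrite /Psi /sigma_hat (behead_PhiE pu1) // (behead_PhiE pu2) //.
  case/(fill_desc_inj pu1 pu2) => eD eB.
  apply: (inj_map succn_inj).
  (* The letter [1] that ends both words serves as the initial common suffix. *)
  apply: (free213_determined (uniq_r pu1) (uniq_r pu2) f1 f2 eD eB (esym _) (esym _)).
  + exact: cats1.
  + exact: cats1.
  by rewrite (permPl pu1) perm_sym.
move=> t pt /avoids321P ft.
(* Array positions begin at [2], indices of a word at [0]. *)
pose T k := nth 0 t (k - 2).
have tE : t = [seq T k | k <- iota 2 n].
  have st : size t = n by rewrite (perm_size pt) size_iota.
  apply: (@eq_from_nth _ 0); rewrite ?size_map ?size_iota // => i i_n.
  by rewrite (nth_map 0) ?size_iota -?st // nth_iota -?st // /T addKn.
rewrite {}tE in pt ft *.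
have h1 : ~~ predC (deficient_value n T) 1.
  by rewrite /= negbK deficient_value1.
(* [g] and [h] are the complements of the deficient positions and of their values, so that these
   become the descent tops and descent bottoms of [rcons u 1]. *)
have [u [pu fu su hu]] := link_exists (count_deficient pt) hn
  (count_deficient_all pt hn) h1.
have uS : map S (map predn u) = u.
  rewrite -map_comp; apply: map_id_in => x.
  by rewrite (perm_mem pu) mem_iota /=; lia.
have u1 : {in u, forall x, 1 < x} by move=> x; rewrite (perm_mem pu) mem_iota => /andP[].
exists (map predn u); split.
- apply: (perm_map_inj succn_inj); rewrite uS (permPl pu).
  by rewrite -[in iota 2 n](add1n 1) iotaDl.
- by apply/avoids213P; rewrite -triple_free_map_S uS -free213_rcons1.
rewrite /Psi /sigma_hat uS (behead_PhiE pu) //; apply/eq_in_map => k kn.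
have [eD eB] := mem_link_desc su hu.
rewrite -[RHS](fill_deficient pt ft) //; apply: eq_fill => x xn /=.
  by rewrite eD ?(perm_mem pu) //= negbK.
rewrite eB /= ?negbK // (perm_mem (perm_r pu)).
by move: xn; rewrite !mem_iota; lia.
Qed.
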